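(* Let $P$ be a finite graded poset with levels $P_1,\dots,P_k$ ($k \ge 1$), and let $\lambda_1,\dots,\lambda_k \ge 1$. For $x \in P_i$ put $\lambda_x = \lambda_i$. Then $$\sum_{I \in \mathcal A(P)} \prod_{x \in I} \lambda_x \le f_P(\lambda_1,\dots,\lambda_k).$$
   Context: A finite poset $P$ is graded with levels $P_1,\dots,P_k$ if every maximal chain has exactly $k$ elements, and $P_i$ is the set of elements occurring as the $i$-th smallest element of some maximal chain. $\mathcal A(P)$ is the family of antichains of $P$ (sets of pairwise incomparable elements), including the empty set. All of the following notions are computed inside the poset under consideration. - For $v \in P$ and a level index $j$, $N^j(v)$ is the set of elements of $P_j$ comparable to $v$ (other than $v$), and $d^j(v) = |N^j(v)|$. - For $v \in P_i$ with $i \ge 2$, set $d_{N^{i-1}(v)} = \min\{d^i(w) : w \in N^{i-1}(v)\}$. - For $v \in P_i$, $P_{<v} = \{z \in P : z < v\}$, regarded as a graded poset with levels $P_j \cap P_{<v}$ for $j = 1,\dots,i-1$. The function $f$ is defined recursively. - For a poset $Q$ with one level, $f_Q(\lambda_1) = (1+\lambda_1)^{|Q|}$. - For $k \ge 2$, $f_P(\lambda_1,\dots,\lambda_k) = \prod_{v \in P_k}\Bigl((1+\lambda_k)^{d_{N^{k-1}(v)}} + f_{P_{<v}}(\lambda_1,\dots,\lambda_{k-1}) - 1\Bigr)^{1/d_{N^{k-1}(v)}}$. *)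

(* Defs.v *)
From mathcomp Require Import all_boot all_order all_algebra.
From mathcomp Require Import reals exp.

Set Implicit Arguments.
Unset Strict Implicit.
Unset Printing Implicit Defensive.

Import Order.TTheory GRing.Theory Num.Theory.
Local Open Scope ring_scope.

(* Subposets of a finite poset [T] are represented by sets [Q : {set T}] with
   the induced order. *)

Definition is_chain (disp : Order.disp_t) (T : finPOrderType disp)
    (C : {set T}) : bool :=
  [forall x in C, forall y in C, (x >=< y)%O].

Definition is_antichain (disp : Order.disp_t) (T : finPOrderType disp)
    (A : {set T}) : bool :=
  [forall x in A, forall y in A, (x != y) ==> ~~ (x >=< y)%O].

Definition antichains (disp : Order.disp_t) (T : finPOrderType disp)
    (Q : {set T}) : {set {set T}} :=
  [set A : {set T} | (A \subset Q) && is_antichain A].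

Definition maximal_chain (disp : Order.disp_t) (T : finPOrderType disp)
    (Q C : {set T}) : bool :=
  maxset (fun D : {set T} => (D \subset Q) && is_chain D) C.

Definition graded (disp : Order.disp_t) (T : finPOrderType disp)
    (Q : {set T}) (k : nat) : Prop :=
  forall C : {set T}, maximal_chain Q C -> #|C| = k.

(* Levels are numbered from 1: [x] is the [i]-th smallest element of a chain
   [C] containing it iff exactly [i] elements of [C] are [<= x]. *)
Definition level (disp : Order.disp_t) (T : finPOrderType disp)
    (Q : {set T}) (i : nat) : {set T} :=
  [set x | [exists C : {set T},
    [&& maximal_chain Q C, x \in C & #|[set y in C | (y <= x)%O]| == i]]].

Section Degrees.
Variables (disp : Order.disp_t) (T : finPOrderType disp).
(* The levels of the poset under consideration. *)
Variable L : nat -> {set T}.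

Definition nbhd (j : nat) (v : T) : {set T} :=
  [set u in L j | (u != v) && (u >=< v)%O].

Definition deg (j : nat) (v : T) : nat := #|nbhd j v|.

(* The minimum of [deg i w] over the neighbours [w] of [v] in level [i - 1].
   The default [#|T|] bounds every degree, so it does not affect the minimum
   when there is such a neighbour, as is the case for [v] in level [i >= 2] of
   a graded poset. *)
Definition min_deg (i : nat) (v : T) : nat :=
  \big[minn/#|T|]_(w in nbhd i.-1 v) deg i w.

End Degrees.

Definition below (disp : Order.disp_t) (T : finPOrderType disp) (v : T) :
  {set T} := [set z | (z < v)%O].

(* [bound k Q L lam] is f_Q(lam 1, ..., lam k) for the graded poset [Q] with
   levels [L 1], ..., [L k]. The value at [k = 0] is a dummy. *)
Fixpoint bound (R : realType) (disp : Order.disp_t) (T : finPOrderType disp)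
    (k : nat) (Q : {set T}) (L : nat -> {set T}) (lam : nat -> R) : R :=
  match k with
  | 0 => 1
  | k'.+1 =>
    if k' is 0 then (1 + lam 1%N) ^+ #|Q|
    else \prod_(v in L k)
      ((1 + lam k) ^+ min_deg L k v
       + bound k' (Q :&: below v) (fun j => L j :&: below v) lam
       - 1) `^ ((min_deg L k v)%:R^-1)
  end.

(* Main.v *)
(* Write d_v for the minimum degree attached to a top element v, and sum over
   the trace A of an antichain on the lower levels: the top elements that may
   be added to A are those v with A empty below v, so the left-hand side is the
   sum over antichains A of the lower levels of
     w(A) prod_v (1 + lam_k [A empty below v]).
   Every lower x satisfies sum_(v > x) 1 / d_v >= 1, so, as all weights are
   >= 1, w(A) <= prod_v w(A below v)^(1 / d_v), and the summand is at most a
   product over v of functions of the trace of A below v. The functional form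
   of Shearer's inequality with exponents 1 / d_v bounds the sum by
     prod_v ((1 + lam_k)^d_v + Z(P_<v) - 1)^(1 / d_v),
   where Z(P_<v) is the weighted count of antichains of P_<v, to which induction
   applies. *)
Require Import Defs.
From mathcomp Require Import all_boot all_order all_algebra.
From mathcomp Require Import reals sequences exp.

Set Implicit Arguments.
Unset Strict Implicit.

Import Order.TTheory GRing.Theory Num.Theory.
Local Open Scope ring_scope.

(** * Real powers of products and a two-term Hoelder inequality *)

Lemma powR_prod (R : realType) (I : Type) (r : seq I) (P : pred I)
    (f : I -> R) (p : R) :
  (forall i, P i -> 0 <= f i) ->
  (\prod_(i <- r | P i) f i) `^ p = \prod_(i <- r | P i) f i `^ p.
Proof.
move=> f_ge0.
(* Nonnegativity of the partial product is carried through the induction because [powRM] asks for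
   it. *)
suff [] : 0 <= \prod_(i <- r | P i) f i /\
  (\prod_(i <- r | P i) f i) `^ p = \prod_(i <- r | P i) f i `^ p by [].
apply: (big_rec2 (fun a b => 0 <= a /\ a `^ p = b)).
  by rewrite ler01 powR1.
by move=> i a b Pi [b_ge0 <-]; rewrite mulr_ge0 ?f_ge0 ?powRM ?f_ge0.
Qed.

Lemma powR_sumr (R : realType) (I : Type) (r : seq I) (P : pred I)
    (p : I -> R) (a : R) :
  0 < a -> a `^ (\sum_(i <- r | P i) p i) = \prod_(i <- r | P i) a `^ p i.
Proof.
move=> a_gt0; apply/esym.
apply: (big_rec2 (fun b s => b = a `^ s)) => [|i b s _ ->].
  by rewrite powRr0.
by rewrite powRD // (gt_eqF a_gt0) implybT.
Qed.

(* Weighted AM-GM for [t / m], [m] the weighted mean, in the form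
   [(t / m) `^ p <= exp (p (t / m - 1))]; the exponents [p (t / m - 1)] sum
   to [0]. *)
Lemma prod_powR_le_mean (R : realType) (I : finType) (W : {set I})
    (p t : I -> R) :
  (forall i, i \in W -> 0 < p i) -> 1 <= \sum_(i in W) p i ->
  (forall i, i \in W -> 0 <= t i <= 1) ->
  \prod_(i in W) t i `^ p i <=
    (\sum_(i in W) p i * t i) / \sum_(i in W) p i.
Proof.
move=> p_gt0 sum_p_ge1 t01; set s := \sum_(i in W) p i; set m := _ / s.
have s_gt0 : 0 < s by apply: lt_le_trans sum_p_ge1; rewrite ltr01.
have t_ge0 i : i \in W -> 0 <= t i by move=> /t01 /andP[].
have pt_ge0 i : i \in W -> 0 <= p i * t i.
  by move=> iW; rewrite mulr_ge0 ?t_ge0 // ltW ?p_gt0.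
have m_ge0 : 0 <= m by rewrite divr_ge0 ?(ltW s_gt0) ?sumr_ge0.
have m_le1 : m <= 1.
  rewrite ler_pdivrMr // mul1r; apply: ler_sum => i iW.
  by rewrite ger_pMr ?p_gt0 //; case/andP: (t01 i iW).
(* A zero mean forces every [t i] with [i \in W] to be 0, and [W] is nonempty because [s > 0]; so
   the product has a zero factor. *)
have [m0|m_neq0] := eqVneq m 0.
  have [i iW] : exists i, i \in W.
    apply/set0Pn/negP => /eqP W0.
    by move: s_gt0; rewrite /s W0 big_set0 ltxx.
  have pt0 : \sum_(i in W) p i * t i = 0.
    by apply/eqP; move/eqP: m0; rewrite mulf_eq0 invr_eq0 (gt_eqF s_gt0) orbF.
  have /eqP : p i * t i = 0 by apply: (psumr_eq0P _ pt0).
  rewrite mulf_eq0 gt_eqF ?p_gt0 //= => /eqP ti0.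
  by rewrite m0 (bigD1 i) //= ti0 powR0 ?mul0r // gt_eqF ?p_gt0.
have m_gt0 : 0 < m by rewrite lt_def m_neq0.
(* This is where [1 <= s] enters: raising [m <= 1] to the power [s] can only decrease it. *)
apply: (@le_trans _ _ (m `^ s)); last by rewrite ge1r_powR ?m_gt0.
rewrite powR_sumr // -[leRHS]mul1r -ler_pdivrMr; last first.
  by apply: prodr_gt0 => i _; rewrite powR_gt0.
rewrite -prodf_div.
apply: (@le_trans _ _ (\prod_(i in W) expR (p i * (t i / m - 1)))).
  apply: ler_prod => i iW; rewrite divr_ge0 ?powR_ge0 //=.
  have tm_ge0 : 0 <= t i / m by rewrite mulr_ge0 ?t_ge0 // invr_ge0.
  rewrite -[X in X `^ _ / _](divfK m_neq0) powRM //.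
  rewrite mulfK ?gt_eqF ?powR_gt0 // [p i * _]mulrC expRM.
  rewrite ge0_ler_powR ?nnegrE ?expR_ge0 ?(ltW (p_gt0 _ iW)) //.
  by apply: le_trans (expR_ge1Dx _); rewrite addrC subrK.
rewrite -expR_sum; under eq_bigr do rewrite mulrBr mulr1 mulrA.
rewrite big_split /= sumrN -mulr_suml -/s.
have -> : (\sum_(i in W) p i * t i) / m = s.
  by rewrite -[X in X / m](divfK (lt0r_neq0 s_gt0)) -/m mulrAC divff ?mul1r.
by rewrite subrr expR0.
Qed.

(** Put [c i = a i + b i] and divide by the product of the powers of the [c i]. Weighted AM-GM then
    bounds the two products of ratios [a i / c i] and [b i / c i] by their weighted means, which add
    up to 1. If some [c i] is 0, all three products vanish. *)
Lemma holder_pair (R : realType) (I : finType) (W : {set I})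
    (p a b : I -> R) :
  (forall i, i \in W -> 0 < p i) -> 1 <= \sum_(i in W) p i ->
  (forall i, i \in W -> 0 <= a i) -> (forall i, i \in W -> 0 <= b i) ->
  \prod_(i in W) a i `^ p i + \prod_(i in W) b i `^ p i
    <= \prod_(i in W) (a i + b i) `^ p i.
Proof.
move=> p_gt0 p_ge1 a_ge0 b_ge0.
have s_gt0 : 0 < \sum_(i in W) p i by apply: lt_le_trans p_ge1; rewrite ltr01.
have [/existsP[i /andP[iW /eqP ab0]]|] :=
  boolP [exists i, (i \in W) && (a i + b i == 0)].
  have [a0 b0] : a i = 0 /\ b i = 0.
    by move/eqP: ab0; rewrite paddr_eq0 ?a_ge0 ?b_ge0 // => /andP[/eqP ? /eqP].
  rewrite !(bigD1 i iW) /= ab0 a0 b0 powR0 ?gt_eqF ?p_gt0 //.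
  by rewrite !mul0r addr0.
rewrite negb_exists => /forallP ab_neq0.
have ab_gt0 i : i \in W -> 0 < a i + b i.
  move=> iW; rewrite lt_def addr_ge0 ?a_ge0 ?b_ge0 // andbT.
  by move: (ab_neq0 i); rewrite iW.
pose c i := a i + b i.
have ratio f : (forall i, i \in W -> 0 <= f i <= c i) ->
    \prod_(i in W) f i `^ p i <=
      (\sum_(i in W) p i * (f i / c i)) / (\sum_(i in W) p i)
        * \prod_(i in W) c i `^ p i.
  move=> fP.
  have -> : \prod_(i in W) f i `^ p i =
      (\prod_(i in W) (f i / c i) `^ p i) * \prod_(i in W) c i `^ p i.
    rewrite -big_split; apply: eq_bigr => i iW /=.
    have /andP[f0 _] := fP i iW; have c0 := ab_gt0 i iW.
    by rewrite -powRM ?divfK ?divr_ge0 ?gt_eqF ?(ltW c0).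
  rewrite ler_wpM2r ?prodr_ge0 // => [i _|]; first by rewrite powR_ge0.
  apply: prod_powR_le_mean => // i iW.
  have /andP[f0 fc] := fP i iW; have c0 := ab_gt0 i iW.
  by rewrite divr_ge0 ?(ltW c0) //= ler_pdivrMr ?mul1r.
have /ratio Ha : forall i, i \in W -> 0 <= a i <= c i.
  by move=> i iW; rewrite a_ge0 // lerDl b_ge0.
have /ratio Hb : forall i, i \in W -> 0 <= b i <= c i.
  by move=> i iW; rewrite b_ge0 // lerDr a_ge0.
apply: le_trans (lerD Ha Hb) _; rewrite -mulrDl -mulrDl -big_split /=.
rewrite (eq_bigr p) => [|i iW]; first by rewrite divff ?mul1r ?gt_eqF.
by rewrite -mulrDr -mulrDl divff ?mulr1 // gt_eqF // ab_gt0.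
Qed.

(** * Shearer's inequality in functional form *)

Lemma sum_subsetD1 (V : nmodType) (T : finType) (S : {set T}) (x : T)
    (F : {set T} -> V) : x \in S ->
  \sum_(A : {set T} | A \subset S) F A =
  \sum_(A : {set T} | A \subset S :\ x) (F A + F (x |: A)).
Proof.
move=> xS; rewrite big_split /= (bigID (fun A : {set T} => x \in A)) /= addrC.
congr (_ + _); first by apply: eq_bigl => A; rewrite subsetD1.
rewrite (reindex_onto (fun A => x |: A) (fun A => A :\ x)) /=; last first.
  by move=> A /andP[_ xA]; rewrite setD1K.
apply: eq_bigl => A; rewrite setU11 andbT subUset sub1set xS /= subsetD1.
congr (_ && _); apply/eqP/idP => [<-|xA]; first by rewrite !inE eqxx.
by rewrite setU1K.
Qed.

(* Removing [x] from [S] replaces [h i B] by [h i B + h i (x |: B)] for the [i]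
   with [x \in S_ i]; this step is Hoelder's inequality for sums of two
   terms. *)
Lemma shearer (R : realType) (I T : finType) (V : {set I})
    (p : I -> R) (S_ : I -> {set T}) (S : {set T}) (h : I -> {set T} -> R) :
  (forall i, i \in V -> 0 < p i) ->
  (forall i B, 0 <= h i B) ->
  (forall x, x \in S -> 1 <= \sum_(i in V | x \in S_ i) p i) ->
  \sum_(A : {set T} | A \subset S) \prod_(i in V) h i (A :&: S_ i) `^ p i
  <= \prod_(i in V) (\sum_(B : {set T} | B \subset S :&: S_ i) h i B) `^ p i.
Proof.
move=> p_gt0; move: {2}#|S| (erefl #|S|) => n.
elim: n => [|n IHn] in S h *.
  move=> /eqP; rewrite cards_eq0 => /eqP-> h_ge0 _.
  rewrite (big_pred1 set0) => [|A]; last by rewrite subset0.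
  apply: ler_prod => i _; rewrite powR_ge0 set0I.
  by rewrite (big_pred1 set0) ?lexx // => A; rewrite subset0.
move=> cardS h_ge0 cover.
have /card_gt0P[x xS] : (0 < #|S|)%N by rewrite cardS.
have cardS' : #|S :\ x| = n by move: cardS; rewrite (cardsD1 x) xS => -[].
pose h' i B := if x \in S_ i then h i B + h i (x |: B) else h i B.
have h'_ge0 i B : 0 <= h' i B by rewrite /h'; case: ifP; rewrite ?addr_ge0.
rewrite (sum_subsetD1 _ xS).
apply: (@le_trans _ _ (\sum_(A : {set T} | A \subset S :\ x)
   \prod_(i in V) h' i (A :&: S_ i) `^ p i)); last first.
  apply: le_trans (IHn _ _ cardS' h'_ge0 _) _ => [y|].
    by rewrite in_setD1 => /andP[_]; apply: cover.
  apply: ler_prod => i iV; rewrite powR_ge0 /=.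
  rewrite le_eqVlt; apply/orP; left; apply/eqP; congr (_ `^ _).
  have [xi|xi] := boolP (x \in S_ i); last first.
    under eq_bigr do rewrite /h' (negbTE xi).
    suff -> : (S :\ x) :&: S_ i = S :&: S_ i by [].
    apply/setP=> y; rewrite !inE.
    by case: eqP => [->|//]; rewrite (negbTE xi) !andbF.
  under eq_bigr do rewrite /h' xi.
  rewrite (@sum_subsetD1 _ _ (S :&: S_ i) x _) ?inE ?xS //.
  by apply: eq_bigl => A; rewrite setIDAC.
apply: ler_sum => A; rewrite subsetD1 => /andP[_ xA].
(* Outside [W], adding [x] does not change the trace on [S_ i], so those factors are common to all
   three products and are pulled out. On [W] the exponents sum to at least 1 by the cover condition
   at [x]. *)
pose W := [set i in V | x \in S_ i].
have split_W (F : I -> R) :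
    \prod_(i in V) F i = (\prod_(i in W) F i) * \prod_(i in V :\: W) F i.
  by rewrite (big_setID W) (setIidPr _) //; apply/subsetP=> i /[!inE] /andP[].
have VW i : i \in V :\: W -> x \notin S_ i.
  by rewrite !inE => /andP[+ iV]; rewrite iV.
rewrite !split_W.
have -> : \prod_(i in V :\: W) h i ((x |: A) :&: S_ i) `^ p i =
          \prod_(i in V :\: W) h i (A :&: S_ i) `^ p i.
  apply: eq_bigr => i /VW xi; congr (h i _ `^ _).
  apply/setP=> y; rewrite !inE.
  by case: eqP => [->|//]; rewrite (negbTE xi) !andbF.
have -> : \prod_(i in V :\: W) h' i (A :&: S_ i) `^ p i =
          \prod_(i in V :\: W) h i (A :&: S_ i) `^ p i.
  by apply: eq_bigr => i /VW xi; rewrite /h' (negbTE xi).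
rewrite -mulrDl ler_wpM2r ?prodr_ge0 // => [i _|]; first by rewrite powR_ge0.
have -> : \prod_(i in W) h' i (A :&: S_ i) `^ p i =
   \prod_(i in W) (h i (A :&: S_ i) + h i ((x |: A) :&: S_ i)) `^ p i.
  apply: eq_bigr => i /[!inE] /andP[_ xi]; rewrite /h' xi setIUl.
  by rewrite (setIidPl (_ : [set x] \subset S_ i)) ?sub1set.
apply: holder_pair => // [i /[!inE] /andP[iV _]|]; first exact: p_gt0.
by under eq_bigl do rewrite inE; exact: cover.
Qed.

(** * Rank functions of graded posets *)

(* The consequences of gradedness on which the induction runs: they pass to
   [Q :&: below v]. *)
Record ranked (disp : Order.disp_t) (T : finPOrderType disp) (Q : {set T})
    (L : nat -> {set T}) (rho : T -> nat) (k : nat) : Prop := Ranked {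
  ranked_bounds : forall x, x \in Q -> (1 <= rho x <= k)%N;
  ranked_level : forall i, (1 <= i <= k)%N -> L i = [set x in Q | rho x == i];
  ranked_lt : forall x y, x \in Q -> y \in Q -> (x < y)%O ->
    (rho x < rho y)%N;
  ranked_pred : forall x y, x \in Q -> y \in Q -> (x < y)%O ->
    ((rho x).+1 < rho y)%N ->
    exists z, [/\ z \in Q, (x < z)%O, (z < y)%O & (rho z).+1 = rho y];
  ranked_top : forall x, x \in Q -> (rho x < k)%N ->
    exists y, [/\ y \in Q, (x < y)%O & rho y = k]
}.

Section Ranked.
Context {disp : Order.disp_t} {T : finPOrderType disp}.
Implicit Types (Q A C D : {set T}) (L : nat -> {set T}) (rho : T -> nat).

Lemma ranked_below Q L rho k v : ranked Q L rho k.+1 -> v \in L k.+1 ->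
  ranked (Q :&: below v) (fun j => L j :&: below v) rho k.
Proof.
move=> rQ; rewrite (ranked_level rQ) ?leqnn // inE => /andP[vQ /eqP rv].
have rho_le x : x \in Q :&: below v -> (1 <= rho x <= k)%N.
  rewrite !inE => /andP[xQ xv]; have /andP[-> _] := ranked_bounds rQ xQ.
  by have := ranked_lt rQ xQ vQ xv; rewrite rv.
split=> // [i /andP[i1 ik]|x y|x y|x] /=.
- rewrite (ranked_level rQ) ?i1 ?leqW //.
  by apply/setP=> x; rewrite !inE andbAC.
- by rewrite !inE => /andP[xQ _] /andP[yQ _]; apply: (ranked_lt rQ xQ yQ).
- rewrite !inE => /andP[xQ _] /andP[yQ yv] xy rxy.
  have [z [zQ xz zy rz]] := ranked_pred rQ xQ yQ xy rxy.
  by exists z; rewrite !inE zQ (lt_trans zy yv).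
- rewrite !inE => /andP[xQ xv] rx.
  (* The element that [ranked_pred] puts just below [v] has rank [k], the new top rank. *)
  have [|z [zQ xz zv rz]] := ranked_pred rQ xQ vQ xv; first by rewrite rv.
  by exists z; rewrite !inE zQ zv; split=> //; apply: succn_inj; rewrite rz.
Qed.

Lemma is_chainP C :
  reflect {in C &, forall x y, (x >=< y)%O} (is_chain C).
Proof.
apply: (iffP forall_inP) => [H x y xC|H x xC]; first exact/forall_inP/H.
by apply/forall_inP => y; apply: H.
Qed.

Lemma is_antichainP A :
  reflect {in A &, forall x y, x != y -> ~~ (x >=< y)%O} (is_antichain A).
Proof.
apply: (iffP forall_inP) => [H x y xA yA|H x xA].
  by apply/implyP; move/forall_inP: (H x xA); apply.
by apply/forall_inP => y yA; apply/implyP; apply: H.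
Qed.

Lemma sub_antichain A A' : A' \subset A -> is_antichain A -> is_antichain A'.
Proof.
move=> /subsetP sA /is_antichainP H; apply/is_antichainP => x y /sA xA /sA.
exact: H.
Qed.

Lemma chain_maximal C : is_chain C ->
  exists2 D, maximal_chain [set: T] D & C \subset D.
Proof.
move=> chC; have [|D mD CD] := maxset_exists
  (P := fun D : {set T} => (D \subset [set: T]) && is_chain D) (C := C).
  by rewrite subsetT.
by exists D.
Qed.

Lemma maximal_chain_chain C : maximal_chain [set: T] C -> is_chain C.
Proof. by move=> /maxsetp /andP[]. Qed.

Lemma maximal_chain_mem C x : maximal_chain [set: T] C ->
  (forall y, y \in C -> (x >=< y)%O) -> x \in C.
Proof.
move=> mC xC; have /is_chainP chC := maximal_chain_chain mC.
have /maxsetP[_ /(_ (x |: C))] := mC.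
rewrite subsetT subsetUr => <- //; first by rewrite setU11.
apply/is_chainP => y z; rewrite !inE.
move=> /predU1P[->|yC] /predU1P[->|zC].
- exact: comparablexx.
- exact: xC.
- by rewrite comparable_sym xC.
- exact: chC.
Qed.

(* Splicing the part of [C] up to [x] with the part of [D] above [x] gives a
   maximal chain. *)
Lemma graded_rank_uniq k C D x : graded [set: T] k ->
  maximal_chain [set: T] C -> maximal_chain [set: T] D -> x \in C -> x \in D ->
  #|[set y in C | (y <= x)%O]| = #|[set y in D | (y <= x)%O]|.
Proof.
move=> grT mC mD xC xD.
have /is_chainP chC := maximal_chain_chain mC.
have /is_chainP chD := maximal_chain_chain mD.
set C1 := [set y in C | _]; set D1 := [set y in D | _].
pose D2 := [set y in D | (x < y)%O].
have mE : maximal_chain [set: T] (C1 :|: D2).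
  apply/maxsetP; split=> [|B /andP[_ /is_chainP chB] sB].
    rewrite subsetT; apply/is_chainP => y z; rewrite !inE.
    move=> /orP[]/andP[yE yx] /orP[]/andP[zE zx].
    - exact: chC.
    - exact: le_comparable (le_trans yx (ltW zx)).
    - exact: ge_comparable (le_trans zx (ltW yx)).
    - exact: chD.
  (* An element [z <= x] of the larger chain [B] is comparable to all of [C]: to the part up to [x]
     within [B], to the rest through [x]. Maximality of [C] puts it in [C]. Symmetrically, an
     element above [x] lies in [D]. *)
  apply/eqP; rewrite eqEsubset sB andbT; apply/subsetP => z zB.
  have xB : x \in B by apply: (subsetP sB); rewrite !inE xC lexx.
  have [zx|] := boolP (z <= x)%O.
    rewrite !inE zx andbT (@maximal_chain_mem C) // => y yC.
    have [yx|] := boolP (y <= x)%O.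
      by apply: chB => //; apply: (subsetP sB); rewrite !inE yC yx.
    move=> yx; apply: le_comparable; apply: le_trans zx _.
    by have := chC _ _ xC yC; rewrite /Order.comparable (negbTE yx) orbF.
  move=> zx; have xz : (x < z)%O.
    have := chB _ _ xB zB; rewrite /Order.comparable (negbTE zx) orbF.
    by rewrite lt_neqAle => ->; rewrite andbT; apply: contraNneq zx => ->.
  rewrite !inE xz andbT (@maximal_chain_mem D) ?orbT // => y yD.
  have [xy|] := boolP (x < y)%O.
    by apply: chB => //; apply: (subsetP sB); rewrite !inE yD xy orbT.
  move=> xy; apply: ge_comparable; apply: le_trans (ltW xz).
  have := chD _ _ xD yD; rewrite /Order.comparable => /orP[|//].
  by rewrite le_eqVlt (negbTE xy) orbF => /eqP->.
have disj A : A \subset [set y | (y <= x)%O] -> #|A :|: D2| = (#|A| + #|D2|)%N.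
  move=> /subsetP Ax; rewrite cardsU (_ : A :&: D2 = set0) ?cards0 ?subn0 //.
  apply/setP=> y; rewrite !inE; apply/and3P => -[/Ax /[!inE] yx _ xy].
  by rewrite (lt_geF xy) in yx.
have DE : D = D1 :|: D2.
  apply/setP=> y; rewrite !inE; have [yD|//] := boolP (y \in D).
  case/orP: (chD _ _ yD xD) => [->//|].
  by rewrite le_eqVlt => /orP[/eqP->|->]; rewrite ?lexx ?orbT.
(* The spliced chain and [D] both have [k] elements and share the part [D2], so their lower parts
   have equal size. *)
apply: (@addIn #|D2|); rewrite -!disj; last 2 first.
- by apply/subsetP => y /[!inE] /andP[].
- by apply/subsetP => y /[!inE] /andP[].
by rewrite -DE (grT _ mE) (grT _ mD).
Qed.

(** The rank of [x] is its position in some chosen maximal chain; by [graded_rank_uniq] any maximal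
    chain through [x] gives the same value. Each property can thus be read off in one maximal chain
    through the elements concerned. *)
Lemma graded_ranked k : graded [set: T] k ->
  exists rho, ranked [set: T] (level [set: T]) rho k.
Proof.
move=> grT.
have max_chain1 x : exists C, maximal_chain [set: T] C && (x \in C).
  have [|C mC xC] := @chain_maximal [set x].
    by apply/is_chainP => y z /set1P-> /set1P->; rewrite comparablexx.
  by exists C; rewrite mC (subsetP xC) ?set11.
have max_chain2 x y : (x < y)%O ->
    exists C, [/\ maximal_chain [set: T] C, x \in C & y \in C].
  move=> xy; have [|C mC /subsetP xyC] := @chain_maximal [set x; y].
    apply/is_chainP => z t /set2P[]-> /set2P[]->; rewrite ?comparablexx //.
      by rewrite lt_comparable.
    by rewrite gt_comparable.
  by exists C; rewrite !xyC ?set21 ?set22.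
pose rho x := #|[set y in xchoose (max_chain1 x) | (y <= x)%O]|.
have rhoE C x : maximal_chain [set: T] C -> x \in C ->
    rho x = #|[set y in C | (y <= x)%O]|.
  have /andP[mD xD] := xchooseP (max_chain1 x).
  by move=> mC xC; exact: (graded_rank_uniq grT mD mC xD xC).
have levelE i : level [set: T] i = [set x in [set: T] | rho x == i].
  apply/setP=> x; rewrite !inE /=; apply/existsP/idP => [[C]|rx].
    by move=> /and3P[mC xC]; rewrite (rhoE C).
  have [C /andP[mC xC]] := max_chain1 x.
  by exists C; rewrite mC xC -rhoE.
have rho_lt x y : (x < y)%O -> (rho x < rho y)%N.
  move=> xy; have [C [mC xC yC]] := max_chain2 _ _ xy.
  rewrite !(rhoE C) //; apply: proper_card; apply/properP; split.
    by apply/subsetP=> z; rewrite !inE => /andP[-> /le_trans->]; rewrite ?ltW.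
  by exists y; rewrite !inE yC ?lexx // lt_geF.
(* As [rho] is strictly increasing, maximising it over part of a chain yields the greatest element
   of that part. *)
have chain_argmax C (p : pred T) x : maximal_chain [set: T] C -> x \in C ->
    p x ->
    exists z, [/\ z \in C, p z & forall t, t \in C -> p t -> (t <= z)%O].
  move=> mC xC px.
  have xCp : [pred t | (t \in C) && p t] x by rewrite /= xC.
  case: (arg_maxnP rho xCp) => z /andP[zC pz] zmax.
  exists z; split=> // t tC pt.
  have /is_chainP chC := maximal_chain_chain mC.
  case/comparable_leP: (chC _ _ tC zC) => // /rho_lt; rewrite ltnNge => /negP[].
  by apply: zmax; rewrite /= tC.
exists rho; split=> //.
- move=> x _; have [C /andP[mC xC]] := max_chain1 x.
  rewrite (rhoE C) // -(grT C mC) subset_leq_card ?andbT.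
    by rewrite card_gt0; apply/set0Pn; exists x; rewrite !inE xC lexx.
  by apply/subsetP=> y /[!inE] /andP[].
- by move=> x y _ _; apply: rho_lt.
- move=> x y _ _ xy rxy; have [C [mC xC yC]] := max_chain2 _ _ xy.
  (* With [z] the greatest element of [C] strictly below [y], the elements of [C] up to [y] are
     those up to [z] and [y] itself. The rank gap between [x] and [y] then excludes [z = x]. *)
  have [z [zC zy zmax]] := chain_argmax C (fun z => (z < y)%O) x mC xC xy.
  have rz : (rho z).+1 = rho y.
    rewrite !(rhoE C) // [RHS](cardsD1 y) !inE yC lexx add1n; congr _.+1.
    apply: eq_card => t; rewrite !inE.
    apply/andP/and3P => [[tC tz]|[ty tC tley]].
      have ty := le_lt_trans tz zy.
      by rewrite ltW ?lt_eqF.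
    by split=> //; apply: zmax; rewrite // lt_neqAle ty.
  exists z; split=> //; rewrite lt_neqAle zmax // andbT.
  by apply: contraTneq rxy => ->; rewrite rz ltnn.
- move=> x _ rx; have [C /andP[mC xC]] := max_chain1 x.
  have [y [yC _ ymax]] := chain_argmax C xpredT x mC xC isT.
  have ry : rho y = k.
    rewrite (rhoE C) // -(grT C mC); apply: eq_card => t; rewrite !inE.
    by have [/ymax->|//] := boolP (t \in C).
  exists y; split=> //; rewrite lt_neqAle ymax // andbT.
  by apply: contraTneq rx => ->; rewrite ry ltnn.
Qed.

End Ranked.

(** * Weighted antichain sums and the induction on levels *)

Lemma prod_1D (R : comPzSemiRingType) (I : finType) (V : {set I}) (g : I -> R) :
  \prod_(i in V) (1 + g i) =
  \sum_(B : {set I} | B \subset V) \prod_(i in B) g i.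
Proof.
pose F i := if i \in V then g i else 0.
transitivity (\prod_i (F i + 1)).
  rewrite big_mkcond; apply: eq_bigr => i _.
  by rewrite /F; case: ifP; rewrite ?add0r // addrC.
rewrite bigA_distr big_mkcond [RHS]big_mkcond; apply: eq_bigr => B _ /=.
rewrite -big_mkcond /=; case: ifPn => [/subsetP BV|/subsetPn[i iB iV]].
  by apply: eq_bigr => i /BV iV; rewrite /F iV.
by rewrite (bigD1 i) //= /F (negbTE iV) mul0r.
Qed.

Section Antichains.
Context {R : realType} {disp : Order.disp_t} {T : finPOrderType disp}.
Implicit Types (Q A B V : {set T}).

(** An antichain [I] splits into [A], its part off [V], and [B], its part in [V], and no element of
    [A] lies below an element of [B]. The inequality can be strict: for an arbitrary [V], pairs
    whose union is not an antichain may be counted on the right. *)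
Lemma sum_antichains_split Q V (w : T -> R) : V \subset Q ->
  (forall x, x \in Q -> 0 <= w x) ->
  \sum_(I in antichains Q) \prod_(x in I) w x
  <= \sum_(A : {set T} | A \subset Q :\: V)
       (is_antichain A)%:R * (\prod_(x in A) w x) *
       \prod_(v in V) (1 + (A :&: below v == set0)%:R * w v).
Proof.
move=> VQ w_ge0; under [leRHS]eq_bigr do rewrite prod_1D mulr_sumr.
pose D := Q :\: V.
rewrite pair_big_dep /= (reindex_onto (fun u : {set T} * {set T} => u.1 :|: u.2)
  (fun I => (I :&: D, I :&: V))) /=; last first.
  move=> I; rewrite inE => /andP[/subsetP IQ _]; rewrite -setIUr.
  apply/setIidPl/subsetP => x /IQ xQ; rewrite !inE xQ andbT.
  by rewrite orbC orbN.
(* The comparison runs over all pairs; those that do not come from an antichain contribute 0 on the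
   left and a nonnegative term on the right. *)
rewrite big_mkcond [leRHS]big_mkcond; apply: ler_sum => -[A B] _ /=.
case: ifPn => [|_]; last first.
  case: ifPn => // /andP[/subsetP AD /subsetP BV].
  rewrite !mulr_ge0 ?prodr_ge0 // => [x /AD|x /BV /(subsetP VQ) xQ].
    by rewrite inE => /andP[_ /w_ge0].
  by rewrite mulr_ge0 ?w_ge0.
rewrite inE => /andP[/andP[ABQ ABanti] /eqP[AE BE]].
have AD : A \subset Q :\: V by rewrite -AE subsetIr.
have BV : B \subset V by rewrite -BE subsetIr.
rewrite AD BV (sub_antichain _ ABanti) ?subsetUl // mul1r.
have AB0 : [disjoint A & B].
  rewrite disjoint_subset; apply/subsetP => x /(subsetP AD).
  by rewrite !inE => /andP[xV _]; apply: contra xV; apply: (subsetP BV).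
rewrite (eq_bigl [predU A & B]); last by move=> x; rewrite !inE.
rewrite bigU //= le_eqVlt; apply/orP; left; apply/eqP; congr (_ * _).
apply: eq_bigr => v vB; have -> : A :&: below v = set0;
  last by rewrite eqxx mul1r.
apply/setP=> x; rewrite !inE; apply/negP=> /andP[xA xv].
have /is_antichainP/(_ x v) := ABanti.
by rewrite !inE xA vB orbT lt_eqF //= lt_comparable // => /(_ isT isT isT).
Qed.

(** The default [#|T|] is positive because [v] exists, and each neighbour of [v] has [v] among its
    own neighbours in level [i]. *)
Lemma min_deg_gt0 (L : nat -> {set T}) i v : v \in L i ->
  (0 < min_deg L i v)%N.
Proof.
move=> vL; rewrite /min_deg; apply: (big_ind (fun m => 0 < m)%N) => [|a b|w].
- by apply/card_gt0P; exists v.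
- by rewrite leq_min => ->.
rewrite inE => /and3P[_ wv cwv]; apply/card_gt0P; exists v.
by rewrite !inE vL eq_sym wv comparable_sym.
Qed.

Lemma min_deg_le (L : nat -> {set T}) i v w : w \in nbhd L i.-1 v ->
  (min_deg L i v <= deg L i w)%N.
Proof.
by move=> wv; rewrite /min_deg -minEnat; exact: (bigmin_le_cond _ (deg L i) wv).
Qed.

(* Some [w >= x] lies on level [k + 1], just below the top, and the [deg w]
   elements [v > w] of the top level satisfy [min_deg v <= deg w]. *)
Lemma ranked_fractional_cover Q (L : nat -> {set T}) (rho : T -> nat) k x :
  ranked Q L rho k.+2 -> x \in Q :\: L k.+2 ->
  1 <= \sum_(v in L k.+2 | x \in below v) ((min_deg L k.+2 v)%:R^-1 : R).
Proof.
move=> rQ /setDP[xQ]; rewrite {1}(ranked_level rQ) ?leqnn // inE xQ => rx.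
have {}rx : (rho x < k.+2)%N.
  by rewrite ltn_neqAle rx; case/andP: (ranked_bounds rQ xQ).
have [y [yQ xy ry]] := ranked_top rQ xQ rx.
have [w [wQ xw wy rw]] : exists w,
    [/\ w \in Q, (x <= w)%O, (w < y)%O & rho w = k.+1].
  have := rx; rewrite ltnS leq_eqVlt => /predU1P[rx1|rx1]; first by exists x.
  have [|w [wQ xw wy rw]] := ranked_pred rQ xQ yQ xy; first by rewrite ry.
  by exists w; split=> //; [apply: ltW | apply: succn_inj; rewrite rw].
have nbhd_gt v : v \in nbhd L k.+2 w -> (w < v)%O.
  rewrite inE (ranked_level rQ) ?leqnn // inE => /and3P[/andP[vQ /eqP rv] vw].
  rewrite /Order.comparable le_eqVlt (negbTE vw) /= [(w < v)%O]lt_def vw.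
  by case/orP=> // /(ranked_lt rQ vQ wQ); rewrite rv rw ltnNge leqnSn.
have deg_gt0 : (0 < deg L k.+2 w)%N.
  apply/card_gt0P; exists y.
  rewrite !inE gt_eqF // gt_comparable // (ranked_level rQ) ?leqnn // inE yQ ry.
  by rewrite eqxx.
have sum1 : \sum_(v in nbhd L k.+2 w) ((deg L k.+2 w)%:R^-1 : R) = 1.
  by rewrite sumr_const -[LHS]mulr_natr mulVf // pnatr_eq0 -lt0n.
rewrite -[leLHS]sum1 big_mkcond [leRHS]big_mkcond; apply: ler_sum => v _ /=.
case: ifPn => [vw|_]; last by case: ifP => // _; rewrite invr_ge0 ler0n.
have wv := nbhd_gt v vw.
have vL : v \in L k.+2 by move: vw; rewrite inE => /andP[].
rewrite vL inE (le_lt_trans xw wv) lef_pV2 ?posrE ?ltr0n ?min_deg_gt0 //.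
rewrite ler_nat min_deg_le // !inE lt_eqF // lt_comparable //.
by rewrite (ranked_level rQ) ?leqnSn // inE wQ rw eqxx.
Qed.

(** The rank function and the weights stay fixed while [Q] and [L] vary in the induction: [rho] also
    ranks each [Q :&: below v], so the weights need no restriction. *)
Lemma sum_antichains_le_bound k Q (L : nat -> {set T}) (rho : T -> nat)
    (lam : nat -> R) (w : T -> R) :
  ranked Q L rho k.+1 ->
  (forall i, (1 <= i <= k.+1)%N -> 1 <= lam i) ->
  (forall x, x \in Q -> w x = lam (rho x)) ->
  \sum_(I in antichains Q) \prod_(x in I) w x <= bound k.+1 Q L lam.
Proof.
move=> + + wE; elim: k => [|k IHk] in Q L wE *.
  move=> rQ lam_ge1; rewrite /bound.
  have rho1 x : x \in Q -> rho x = 1%N.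
    move=> xQ; apply/eqP.
    by rewrite eqn_leq andbC; apply: ranked_bounds rQ _ xQ.
  have -> : (1 + lam 1%N) ^+ #|Q| = \prod_(x in Q) (1 + w x).
    by rewrite -prodr_const; apply: eq_bigr => x xQ; rewrite wE ?rho1.
  (* With one level the bound is the sum over all subsets of [Q], antichains or not. *)
  rewrite prod_1D big_mkcond [leRHS]big_mkcond; apply: ler_sum => A _.
  rewrite inE /=; case: ifPn => [/andP[-> _] //|_].
  case: ifP => // /subsetP AQ; apply: prodr_ge0 => x /AQ xQ.
  by rewrite wE ?rho1 // (le_trans ler01) ?lam_ge1.
move=> rQ lam_ge1; set V := L k.+2.
have VE : V = [set x in Q | rho x == k.+2].
  by rewrite /V {1}(ranked_level rQ) ?leqnn.
have VQ : V \subset Q by rewrite VE; apply/subsetP=> x /[!inE] /andP[].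
have w_ge1 x : x \in Q -> 1 <= w x.
  by move=> xQ; rewrite wE // lam_ge1 // (ranked_bounds rQ).
have w_ge0 x : x \in Q -> 0 <= w x by move=> /w_ge1; apply: le_trans.
have wV v : v \in V -> w v = lam k.+2.
  by rewrite VE inE => /andP[vQ /eqP rv]; rewrite wE ?rv.
have lamk_ge0 : 0 <= lam k.+2 by rewrite (le_trans ler01) ?lam_ge1 // leqnn.
pose d v := min_deg L k.+2 v.
have d_gt0 v : v \in V -> (0 < d v)%N by apply: min_deg_gt0.
pose p v : R := (d v)%:R^-1.
have p_gt0 v : v \in V -> 0 < p v by move=> vV; rewrite invr_gt0 ltr0n d_gt0.
have cover x : x \in Q :\: V -> 1 <= \sum_(v in V | x \in below v) p v.
  exact: ranked_fractional_cover rQ.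
(* The sign of [w] is known only on [Q], whereas [shearer] wants [h] nonnegative on every set; the
   absolute values disappear on subsets of [Q]. *)
pose W A : R := \prod_(x in A) `|w x|.
have W_ge0 A : 0 <= W A by rewrite prodr_ge0.
(* The exponent [d v] cancels against [p v], leaving the factor [1 + lam k.+2] when the trace below
   [v] is empty. *)
pose h v A : R := (is_antichain A)%:R * W A *
  (if A == set0 then (1 + lam k.+2) ^+ d v else 1).
have h_ge0 v A : 0 <= h v A.
  by rewrite !mulr_ge0 //; case: ifP; rewrite ?exprn_ge0 ?addr_ge0.
apply: le_trans (sum_antichains_split VQ w_ge0) _.
apply: (@le_trans _ _ (\sum_(A : {set T} | A \subset Q :\: V)
    \prod_(v in V) h v (A :&: below v) `^ p v)).
  apply: ler_sum => A AQ.
  have AP x : x \in A -> x \in Q :\: V by apply: (subsetP AQ).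
  have [Aanti|_] := boolP (is_antichain A); last first.
    by rewrite !mul0r prodr_ge0 // => v _; rewrite powR_ge0.
  rewrite mul1r.
  have -> : \prod_(v in V) h v (A :&: below v) `^ p v =
      (\prod_(v in V) W (A :&: below v) `^ p v) *
      \prod_(v in V) (1 + (A :&: below v == set0)%:R * w v).
    rewrite -big_split; apply: eq_bigr => v vV /=.
    rewrite /h (sub_antichain _ Aanti) ?subsetIl // mul1r powRM //; last first.
      by case: ifP; rewrite ?exprn_ge0 ?addr_ge0.
    congr (_ * _); case: ifP; last by rewrite powR1 mul0r addr0.
    rewrite mul1r wV // -powR_mulrn ?addr_ge0 // -powRrM.
    rewrite mulfV ?powRr1 ?addr_ge0 //.
    by rewrite pnatr_eq0 -lt0n d_gt0.
  rewrite ler_wpM2r //.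
    rewrite prodr_ge0 // => v /(subsetP VQ) vQ.
    by rewrite addr_ge0 ?mulr_ge0 ?w_ge0.
  (* Exchanging the products collects, for each [x], the exponents of all [v] above it. Their sum is
     at least 1, so [1 <= w x] gives the bound factor by factor. *)
  have -> : \prod_(v in V) W (A :&: below v) `^ p v =
      \prod_(x in A) w x `^ (\sum_(v in V | x \in below v) p v).
    transitivity (\prod_(v in V) \prod_(x in A | x \in below v) w x `^ p v).
      apply: eq_bigr => v vV; rewrite /W powR_prod //.
      rewrite (eq_bigl [pred x in A | x \in below v]); last first.
        by move=> x; rewrite !inE.
      apply: eq_bigr => x /andP[/AP /[!inE] /andP[_ xQ] _].
      by rewrite ger0_norm ?w_ge0.
    rewrite (exchange_big_dep [in A]) /= => [|v x _ /andP[]//].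
    apply: eq_bigr => x xA; rewrite powR_sumr; last first.
      apply: lt_le_trans (w_ge1 _ _); first exact: ltr01.
      by have := AP x xA; rewrite inE => /andP[].
    by apply: eq_bigl => v; rewrite xA.
  apply: ler_prod => x xA.
  have xQ : x \in Q by have := AP x xA; rewrite inE => /andP[].
  by rewrite w_ge0 //= le1r_powR ?w_ge1 ?cover ?AP.
apply: le_trans (shearer p_gt0 h_ge0 cover) _.
pose b v := bound k.+1 (Q :&: below v) (fun j => L j :&: below v) lam.
have -> : bound k.+2 Q L lam =
  \prod_(v in V) ((1 + lam k.+2) ^+ d v + b v - 1) `^ p v by [].
apply: ler_prod => v vV; rewrite powR_ge0 /=.
have vQ := subsetP VQ v vV.
(* All elements of [V] have the same rank, so none lies below [v]. *)
have sE : (Q :\: V) :&: below v = Q :&: below v.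
  apply/setP=> x; rewrite !inE.
  case: (boolP (x < v)%O); rewrite ?andbF // => xv.
  rewrite !andbT; case: (boolP (x \in Q)); rewrite ?andbF // => xQ.
  rewrite VE inE xQ andbT; apply/eqP => rx.
  have := ranked_lt rQ xQ vQ xv; rewrite rx.
  by move: vV; rewrite VE inE => /andP[_ /eqP->]; rewrite ltnn.
rewrite sE.
have Zb : \sum_(I in antichains (Q :&: below v)) \prod_(x in I) w x <= b v.
  apply: IHk (ranked_below rQ vV) _ => [x /[!inE] /andP[xQ _]|i /andP[i1 ik]].
    exact: wE.
  by rewrite lam_ge1 // i1 leqW.
have anti0 : is_antichain (set0 : {set T}).
  by apply/is_antichainP => x y; rewrite inE.
(* Summing [h v] counts the antichains below [v], except that the empty one weighs
   [(1 + lam k.+2) ^+ d v] in place of 1. *)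
have -> : \sum_(B : {set T} | B \subset Q :&: below v) h v B =
    (1 + lam k.+2) ^+ d v +
    \sum_(I in antichains (Q :&: below v)) \prod_(x in I) w x - 1.
  rewrite (bigD1 set0) ?sub0set //= [in RHS](bigD1 set0) /=; last first.
    by rewrite inE sub0set.
  rewrite /h eqxx anti0 /W !big_set0 !mul1r -[RHS]addrA.
  rewrite [1 + _ - 1]addrAC subrr add0r.
  congr (_ + _); rewrite big_mkcond [RHS]big_mkcond; apply: eq_bigr => A _.
  rewrite inE; case: (boolP (A \subset _)) => //= /subsetP AQ.
  case: eqP => //= _; rewrite ?andbF // !andbT mulr1.
  case: ifP; rewrite ?mul0r // mul1r => _.
  apply: eq_bigr => x /AQ /[!inE] /andP[xQ _].
  by rewrite ger0_norm ?w_ge0.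
(* The empty antichain alone contributes 1. This keeps the bases nonnegative, as monotonicity of the
   power requires. *)
have Z_ge1 : 1 <= \sum_(I in antichains (Q :&: below v)) \prod_(x in I) w x.
  rewrite (bigD1 set0) /=; last by rewrite inE sub0set.
  rewrite big_set0 lerDl.
  apply: sumr_ge0 => A; rewrite inE => /andP[/andP[/subsetP AQ _] _].
  by apply: prodr_ge0 => x /AQ /[!inE] /andP[xQ _]; rewrite w_ge0.
have E_ge0 z : 1 <= z -> 0 <= (1 + lam k.+2) ^+ d v + z - 1.
  move=> z1; rewrite -addrA; apply: addr_ge0; last by rewrite subr_ge0.
  by rewrite exprn_ge0 ?addr_ge0.
rewrite ge0_ler_powR ?nnegrE ?E_ge0 ?invr_ge0 ?(le_trans Z_ge1) //.
by rewrite lerD2r lerD2l.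
Qed.

End Antichains.

Unset Implicit Arguments.

Theorem theorem3p3 (R : realType) (disp : Order.disp_t)
    (P : finPOrderType disp) (k : nat) (lam : nat -> R) (lamx : P -> R)
    (k_gt0 : (1 <= k)%N)
    (gradedP : graded [set: P] k)
    (lam_ge1 : forall i : nat, (1 <= i <= k)%N -> 1 <= lam i)
    (lamxE : forall (i : nat) (x : P), (1 <= i <= k)%N ->
       x \in level [set: P] i -> lamx x = lam i) :
  \sum_(I in antichains [set: P]) \prod_(x in I) lamx x
    <= bound k [set: P] (level [set: P]) lam.
Proof.
case: k k_gt0 gradedP lam_ge1 lamxE => // k _ /graded_ranked[rho rP].
move=> lam_ge1 lamxE.
apply: (sum_antichains_le_bound rP lam_ge1) => x xP.
have rx := ranked_bounds rP xP.
by apply: lamxE => //; rewrite (ranked_level rP) // inE xP /=.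
Qed.
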